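(* Let $G$ be a digraph and $\omega\in\mathcal{W}(G)$. Then, in $\mathcal{T}\langle\mathcal{W}(G)\rangle$, the antipode $S(\omega)$ calculated on $\omega$ is \[S(\omega)=-\omega - \sum_{e\in E\mathrm{AdC}(\omega)} (-1)^{|e|}T_e=-\omega-\sum_{n=1}^{|\mathrm{AdC}(\omega)|}\sum_{\substack{c_1\leqslant_{\text{time}}\dots \leqslant_{\text{time}}c_n\\ c_i\in \mathrm{AdC}(\omega)} }(-1)^{n}\,T_{c_1|\dots|c_n},\] where $|\mathrm{AdC}(\omega)|$ designates the cardinality of $\mathrm{AdC}(\omega)$.
   Context: Walks $\omega=w_0\cdots w_\ell$ on a digraph $G$; $\mathcal{W}(G)$ is the $\mathbb{K}$-vector space ($\mathrm{char}\,\mathbb{K}=0$) they span; $\mathcal{T}\langle\mathcal{W}(G)\rangle$ is its tensor algebra, elements written $\omega_1|\dots|\omega_p$, with concatenation product $\cdot$ and unit $\mathbf{1}$. For $w_k=w_{k'}$, $k<k'$: $\omega^{k,k'}=w_k\cdots w_{k'}$, $\omega_{k,k'}=w_0\cdots w_kw_{k'+1}\cdots w_\ell$. $\mathrm{LES}(\omega)$ is the set of closed subwalks erased by Lawler's chronological loop-erasing procedure. $\mathrm{AdC}(\omega)$, the admissible cuts, are the $\omega^{k,k'}\in\mathrm{LES}(\omega)$, $\omega^{k,k'}\neq\omega$, such that either there is no $\omega^{l,l'}\in\mathrm{LES}(\omega)$ with $l\le k<k'<l'$, or for the smallest such one $w_k$ does not appear in $w_{k'+1}\cdots w_{l'}$.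 Extended admissible cuts $E\mathrm{AdC}(\omega)$ are words $c_1|\dots|c_n$ of admissible cuts $\omega^{k_i,k_i'}$ with $k_1<k_1'<\dots<k_n<k_n'$ (non-overlapping); $\omega_c$ denotes the remainder after erasing them. The Hopf algebra structure is $(\mathcal{T}\langle\mathcal{W}(G)\rangle,\cdot,\Delta_{\text{H}})$, with $\Delta_{\text{H}}$ the algebra morphism $\Delta_{\text{H}}(\omega)=\mathbf{1}\otimes\omega+\omega\otimes\mathbf{1}+\sum_{c\in E\mathrm{AdC}(\omega)}\omega_c\otimes\omega^c$; $S$ is its antipode. The time order on $\mathrm{AdC}(\omega)$ is $\omega^{k,k'}\leqslant_{\text{time}}\omega^{l,l'}\iff l\le k<k'\le l'$ or $k<k'<l<l'$ (a total order). For non-overlapping admissible cuts $c_1\leqslant_{\text{time}}\dots\leqslant_{\text{time}}c_n$ and $e=c_1|\dots|c_n$, $|e|:=n$ and $T_e:=\omega_{c_1,\dots,c_n}\otimes(\omega_{c_1,\dots,c_{n-1}})^{c_n}\otimes\cdots\otimes(\omega_{c_1,\dots,c_{i-1}})^{c_i}\otimes\cdots\otimes(\omega_{c_1})^{c_2}\otimes\omega^{c_1}$ (tensor read as an element $|$-word of $\mathcal{T}\langle\mathcal{W}(G)\rangle$), where $\omega_{c_1,\dots,c_j}$ is the remainder after erasing $c_1,\dots,c_j$ and $(\cdot)^{c_i}$ the section $c_i$ in it.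
   Formalization: The first sum runs over all nonempty words of distinct time-ordered admissible cuts (nested cuts allowed) rather than only disjoint words in EAdC(ω), since for ω=1234325 the nested term −125|232|343 occurs in S(ω); the chains in the second sum are taken strict. *)

(* Defs.v *)
From HB Require Import structures.
From mathcomp Require Import all_boot all_order all_algebra finmap.
From mathcomp.multinomials Require Import monalg.

Set Implicit Arguments.
Unset Strict Implicit.
Unset Printing Implicit Defensive.

Import GRing.Theory.

Record digraph := Digraph { vertex :> choiceType; edge : rel vertex }.

Section Walks.
Variable G : digraph.

Definition is_walk (s : seq G) : bool :=
  if s is x :: p then path (@edge G) x p else false.

Record walk := Walk { walk_seq :> seq G; _ : is_walk walk_seq }.

HB.instance Definition _ := [isSub for walk_seq].
HB.instance Definition _ := [Choice of walk by <:].

Implicit Type w : walk.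

Definition vtx w (i : 'I_(size w)) : G := tnth (in_tuple w) i.

(* A pair (k, k') stands for the section w_k ... w_k' at that position, so
   equal subwalks occurring at different positions are different cuts. *)
Definition cut w : finType := ('I_(size w) * 'I_(size w))%type.

(* Lawler's procedure at time i. The state is the list of the positions forming
   the current loop-erased walk, and the list of the sections erased so far.
   When w_i is already visited by the loop-erased walk, at its position k, the
   section from k to i is erased, and the vertex is kept at position k. *)
Definition lawler_step w (st : seq 'I_(size w) * seq (cut w)) (i : 'I_(size w)) :=
  let: (p, L) := st in
  if [seq k <- p | vtx k == vtx i] is k :: _
  then (take (index k p).+1 p, rcons L (k, i))
  else (rcons p i, L).

Definition lawler w : seq 'I_(size w) * seq (cut w) :=
  foldl (@lawler_step w) ([::], [::]) (enum 'I_(size w)).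

Definition LES w : {set cut w} := [set c in (lawler w).2].

Definition remains w (s : seq (cut w)) (i : 'I_(size w)) : bool :=
  ~~ has (fun c : cut w => c.1 < i <= c.2) s.

Definition within w (c : cut w) (i : 'I_(size w)) : bool := c.1 <= i <= c.2.

Definition restr w (P : pred 'I_(size w)) : seq G := [seq vtx i | i <- enum P].

(* The remainder of w after erasing the sections in s. The default value of
   insubd is irrelevant, see val_erase below. *)
Definition erase w (s : seq (cut w)) : walk := insubd w (restr (remains s)).

(* The section c in the remainder of w after erasing the sections in s; the
   default value of insubd is irrelevant, see val_section below. *)
Definition section w (s : seq (cut w)) (c : cut w) : walk :=
  insubd w (restr (predI (within c) (remains s))).

Definition containers w (c : cut w) : {set cut w} :=
  [set d in LES w | (d.1 <= c.1) && (c.2 < d.2)].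

Definition smallest_container w (c d : cut w) : bool :=
  (d \in containers c) &&
  [forall f in containers c, (f.1 <= d.1) && (d.2 <= f.2)].

Definition AdC w : {set cut w} :=
  [set c in LES w | (section [::] c != w) &&
    ((containers c == set0) ||
     [exists d, smallest_container c d &&
       [forall i : 'I_(size w), (c.2 < i <= d.2) ==> (vtx i != vtx c.1)]])].

(* The cuts of such a word are distinct, so it has at most #|AdC w| letters. *)
Definition EAdC w : {set #|AdC w|.-bseq (cut w)} :=
  [set e : #|AdC w|.-bseq (cut w) |
    [&& e != [::] :> seq _, all (mem (AdC w)) e &
        sorted (fun c d : cut w => c.2 < d.1) e]].

Definition time_le w (c d : cut w) : bool :=
  ((d.1 <= c.1) && (c.2 <= d.2)) || (c.2 < d.1).

(* A cut is erased at most once, so chains for time_le are strict. *)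
Definition time_lt w (c d : cut w) : bool := (c != d) && time_le c d.

Definition time_chain w (e : seq (cut w)) : bool :=
  all (mem (AdC w)) e && sorted (@time_lt w) e.

(* The words of admissible cuts on which T_e is defined: unlike in EAdC, the
   cuts are either disjoint or nested, an inner one preceding an outer one.
   The antipode involves the nested ones: for w = 1234325, S(w) contains the
   term - 125|232|343, which is - T_e for e = 343|23432. *)
Definition TAdC w : {set #|AdC w|.-bseq (cut w)} :=
  [set e : #|AdC w|.-bseq (cut w) | (e != [::] :> seq _) && time_chain e].

(* For e = c_1|...|c_n and s empty, the walks w^{c_1}, (w_{c_1})^{c_2}, ...,
   (w_{c_1,...,c_(n-1)})^{c_n}. *)
Fixpoint sections w (s e : seq (cut w)) : seq walk :=
  if e is c :: e' then section s c :: sections (rcons s c) e' else [::].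

Lemma lawlerP w : let: (p, L) := lawler w in
  {in L, forall c : cut w, [&& c.1 < c.2 & vtx c.1 == vtx c.2]} /\
  {in L &, forall c d : cut w, d.1 < c.1 <= d.2 -> c.2 <= d.2}.
Proof.
pose inv (i : nat) (st : seq 'I_(size w) * seq (cut w)) :=
  [/\ sorted (fun k l : 'I_(size w) => k < l) st.1,
      {in st.1, forall k : 'I_(size w), k < i},
      {in st.2, forall c : cut w, [&& c.1 < c.2, c.2 < i & vtx c.1 == vtx c.2]},
      {in st.2 & st.1, forall (c : cut w) (k : 'I_(size w)),
         ~~ (c.1 < k <= c.2)} &
      {in st.2 &, forall c d : cut w, d.1 < c.1 <= d.2 -> c.2 <= d.2}].
have ltT : transitive (fun k l : 'I_(size w) => k < l).
  by move=> x y z; apply: ltn_trans.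
have step (i : 'I_(size w)) st : inv i st -> inv i.+1 (lawler_step st i).
  case: st => p L [/= sp pi Li Lp LL].
  case E: [seq k <- p | vtx k == vtx i] => [|k q].
    split=> /=.
    - case: p sp pi {Lp E} => //= x p xp pi; rewrite rcons_path xp /=.
      by apply: pi; apply: mem_last.
    - by move=> k; rewrite mem_rcons inE => /predU1P[->//|/pi /ltnW].
    - by move=> c /Li /and3P[-> ci ->]; rewrite ltnS ltnW.
    - move=> c k Lc; rewrite mem_rcons inE => /predU1P[->|]; last exact: Lp.
      by case/and3P: (Li _ Lc) => _ ci _; rewrite negb_and orbC -ltnNge ci.
    - exact: LL.
  have : k \in [seq k <- p | vtx k == vtx i] by rewrite E mem_head.
  rewrite mem_filter => /andP[/eqP ki kp].
  have sub l : l \in take (index k p).+1 p -> (l \in p) && (l <= k).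
    move=> lt; rewrite (mem_take lt) /=.
    have ip : index k p < size p by rewrite index_mem.
    have : l \in rcons (take (index k p) p) k.
      by move: lt; rewrite (take_nth k) // nth_index.
    have : sorted (fun k l : 'I_(size w) => k < l) (rcons (take (index k p) p) k).
      by have := take_sorted (index k p).+1 sp; rewrite (take_nth k) ?nth_index.
    rewrite mem_rcons inE -cats1 sorted_pairwise // pairwise_cat allrel1r.
    by case/and3P=> /allP h _ _ /predU1P[->//|/h /ltnW].
  split=> /=.
  - exact: take_sorted.
  - by move=> l /mem_take /pi /ltnW.
  - move=> c; rewrite mem_rcons inE => /predU1P[->/=|/Li/and3P[-> ci ->]].
      by rewrite pi // ki eqxx ltnS leqnn.
    by rewrite ltnS ltnW.
  - move=> c l; rewrite mem_rcons inE => /predU1P[->/= /sub/andP[_ lk]|Lc /sub/andP[lp _]].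
      by rewrite ltnNge lk.
    exact: Lp.
  - move=> c d; rewrite !mem_rcons !inE => /predU1P[->|Lc] /predU1P[->|Ld] //=.
    + by rewrite (negPf (Lp _ _ Ld kp)).
    + by move=> _; case/and3P: (Li _ Lc) => _ /ltnW.
    + exact: LL.
suff : inv (size w) (lawler w).
  case: (lawler w) => p L [_ _ Li _ LL]; split=> // c /Li /=.
  by case/and3P=> -> _ ->.
rewrite /lawler.
have fold s i st : map val s = iota i (size s) -> inv i st ->
    inv (i + size s) (foldl (@lawler_step w) st s).
  elim: s i st => [|j s IHs] i st /=; first by rewrite addn0.
  by case=> ji js ist; rewrite addnS -addSn; apply: IHs; rewrite // -ji; apply: step; rewrite ji.
have := fold (enum 'I_(size w)) 0 ([::], [::]); rewrite size_enum_ord add0n.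
by apply; [rewrite val_enum_ord | split].
Qed.

Lemma LES_lt w c : c \in LES w -> c.1 < c.2.
Proof.
by rewrite inE; have := lawlerP w; case: (lawler w) => p L [h _] /= /h /andP[].
Qed.

Lemma LES_vtx w c : c \in LES w -> vtx c.1 = vtx c.2.
Proof.
by rewrite inE; have := lawlerP w; case: (lawler w) => p L [h _] /= /h /andP[_ /eqP].
Qed.

Lemma LES_nested w c d :
  c \in LES w -> d \in LES w -> d.1 < c.1 <= d.2 -> c.2 <= d.2.
Proof.
by rewrite !inE; have := lawlerP w; case: (lawler w) => p L [_ h] /=; apply: h.
Qed.

Lemma sorted_filter_iota (r : rel nat) (P : pred nat) a n :
  (forall i j, a <= i < j -> j < a + n -> P i -> P j ->
     (forall m, i < m < j -> ~~ P m) -> r i j) ->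
  sorted r [seq i <- iota a n | P i].
Proof.
have pth x m k : x < m -> P x -> (forall l, x < l < m -> ~~ P l) ->
    (forall i j, x <= i < j -> j < m + k -> P i -> P j ->
      (forall l, i < l < j -> ~~ P l) -> r i j) ->
    path r x [seq i <- iota m k | P i].
  elim: k x m => //= k IH x m xm Px xmP h; case: ifP => Pm /=.
    apply/andP; split; first by apply: h; rewrite ?leqnn ?addnS ?ltnS ?leq_addr.
    apply: IH => //; first by move=> l /andP[/leq_trans/[apply]]; rewrite ltnn.
    move=> i j /andP[mi ij]; rewrite addSnnS; apply: h.
    by rewrite ij (leq_trans (ltnW xm) mi).
  apply: IH => //; first exact: ltnW.
    move=> l /andP[xl]; rewrite ltnS leq_eqVlt => /predU1P[->|lm].
      by rewrite Pm.
    by apply: xmP; rewrite xl.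
  by move=> i j ij; rewrite addSnnS; apply: h.
elim: n a => //= n IH a h; case: ifP => Pa /=.
  apply: pth => //; first by move=> l /andP[/leq_trans/[apply]]; rewrite ltnn.
  by move=> i j ij; rewrite addSnnS; apply: h.
apply: IH => i j /andP[ai ij]; rewrite addSnnS; apply: h.
by rewrite ij ltnW.
Qed.

Lemma restr_walk w (s : seq (cut w)) (a b : nat) :
  {subset s <= LES w} ->
  restr (fun i : 'I_(size w) => (a <= i <= b) && remains s i) != [::] ->
  is_walk (restr (fun i : 'I_(size w) => (a <= i <= b) && remains s i)).
Proof.
move=> sL; set P := (X in restr X); set t := restr P => t0.
have x0 : G by case: t t0 => [|x].
have w0 (i : 'I_(size w)) : vtx i = nth x0 w i by apply: tnth_nth.
pose Q m := if insub m is Some i then P i else false.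
have tE : t = map (nth x0 w) [seq m <- iota 0 (size w) | Q m].
  rewrite -val_enum_ord filter_map -map_comp /t /restr.
  have -> : enum P = [seq i <- enum 'I_(size w) | P i].
    by rewrite {1}/enum_mem -enumT.
  have -> : [seq i <- enum 'I_(size w) | P i] =
            [seq i <- enum 'I_(size w) | preim val Q i].
    by apply: eq_filter => i; rewrite /= /Q valK.
  by apply: eq_map => i; rewrite /= w0.
suff : sorted (@edge G) t by move: t0; clear; case: t.
have ew m : m.+1 < size w -> edge (nth x0 w m) (nth x0 w m.+1).
  case: w {s sL P t t0 w0 Q tE} => -[|x p] //= /(pathP x0) h mp.
  exact: h.
rewrite tE sorted_map; apply: sorted_filter_iota => i j /=.
rewrite add0n => ij jn Qi Qj ijQ.
have [i' i'E Pi] : exists2 i' : 'I_(size w), val i' = i & P i'.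
  by move: Qi; rewrite /Q; case: insubP => // i' _ <-; exists i'.
have [j' j'E Pj] : exists2 i' : 'I_(size w), val i' = j & P i'.
  by move: Qj; rewrite /Q; case: insubP => // i'' _ <-; exists i''.
case: (posnP j) => [j0|j_gt0]; first by rewrite j0 ltn0 in ij.
have jm : j.-1 < size w by rewrite (leq_ltn_trans (leq_pred _)).
suff -> : nth x0 w i = nth x0 w j.-1 by have := ew j.-1; rewrite prednK //; apply.
have [<-//|ij1] := eqVneq i j.-1.
have /andP[ai ri] := Pi; have /andP[aj rj] := Pj.
have er (m : 'I_(size w)) : i < m < j ->
    exists2 c : cut w, c \in s & c.1 < m <= c.2.
  move=> imj; have := ijQ _ imj; rewrite /Q valK /P.
  rewrite (_ : a <= m <= b); last first.
    case/andP: imj => im mj; apply/andP; split.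
      by rewrite (leq_trans _ (ltnW im)) // -i'E; case/andP: ai.
    by rewrite (leq_trans (ltnW mj)) // -j'E; case/andP: aj.
  by rewrite /= negbK => /hasP.
have cl (c : cut w) : c \in s -> c.1 < j.-1 <= c.2 -> (i <= c.1) && (c.2 == j.-1 :> nat).
  move=> cs /andP[c1 c2].
  have /hasPn/(_ _ cs) := ri; have /hasPn/(_ _ cs) := rj.
  rewrite i'E j'E !negb_and -!leqNgt -!ltnNge.
  have -> : (j <= c.1) = false.
    by apply/negbTE; rewrite -ltnNge (leq_trans c1) ?leq_pred.
  rewrite /= => cj /orP[ic|ci]; last first.
    have : j.-1 < i by apply: leq_ltn_trans c2 ci.
    by rewrite prednK // leqNgt ij.
  by rewrite ic eqn_leq c2 -ltnS prednK // cj.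
have [c cs cj] : exists2 c : cut w, c \in s & c.1 < j.-1 <= c.2.
  apply: (er (Ordinal jm)) => /=; rewrite prednK // leqnn andbT.
  by rewrite ltn_neqAle ij1 -ltnS prednK //; case/andP: ij.
have [k] := ubnP (c.1 : nat); elim: k c cs cj => // k IH c cs cj ck.
have /andP[ic /eqP c2] := cl _ cs cj.
have [ci|ci] := eqVneq i c.1.
  by rewrite -c2 ci -!w0; apply: LES_vtx; apply: sL.
have [] := er c.1.
  rewrite ltn_neqAle ci ic /=; case/andP: cj => cj _.
  by rewrite (leq_trans cj) ?leq_pred.
move=> d ds dc; apply: (IH d ds).
  rewrite -c2 (LES_nested (sL _ cs) (sL _ ds) dc) andbT.
  by rewrite c2; case/andP: cj => + _; case/andP: dc => + _; apply: ltn_trans.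
by case/andP: dc => dc _; rewrite -ltnS (leq_trans _ ck).
Qed.

Lemma val_erase w (s : seq (cut w)) :
  {subset s <= LES w} -> val (erase s) = restr (remains s).
Proof.
move=> sL.
have eqP0 : enum (remains s) =
    enum (fun i : 'I_(size w) => (0 <= i <= size w) && remains s i).
  by apply: eq_enum => i; rewrite !unfold_in /= ltnW.
rewrite /erase val_insubd; case: ifP => // /negbT/negP[].
rewrite /restr eqP0; apply: (restr_walk sL); rewrite /restr -eqP0.
have w_gt0 : 0 < size w by case: w {s sL eqP0} => -[].
have : Ordinal w_gt0 \in enum (remains s).
  by rewrite mem_enum unfold_in; apply/hasPn => c _; rewrite ltn0.
by case: (enum _).
Qed.

Lemma val_section w (s : seq (cut w)) (c : cut w) :
  {subset s <= LES w} -> c \in LES w -> all (fun d => time_le d c) s ->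
  val (section s c) = restr (predI (within c) (remains s)).
Proof.
move=> sL cL sc; rewrite /section val_insubd; case: ifP => // /negbT/negP[].
apply: (restr_walk sL); rewrite /restr.
set e := enum _; have : c.1 \in e.
  rewrite mem_enum unfold_in leqnn (ltnW (LES_lt cL)) /=.
  apply/hasPn => d /(allP sc) /orP[/andP[cd _]|dc].
    by rewrite ltnNge cd.
  by rewrite negb_and orbC -ltnNge dc.
by case: e.
Qed.

End Walks.

Section PairMonomial.
Variables M N : monomType.
Let one2 : M * N := (mone, mone).
Let mul2 (x y : M * N) : M * N := (mmul x.1 y.1, mmul x.2 y.2).

Fact mul2A : associative mul2.
Proof. by move=> x y z; rewrite /mul2 /= !mulmA. Qed.
Fact mul12 : left_id one2 mul2.
Proof. by case=> x y; rewrite /mul2 /= !mul1m. Qed.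
Fact mul21 : right_id one2 mul2.
Proof. by case=> x y; rewrite /mul2 /= !mulm1. Qed.
Fact unit2 x y : mul2 x y = one2 -> x = one2 /\ y = one2.
Proof. by case: x y => [a b] [c d] [/unitm[-> ->] /unitm[-> ->]]. Qed.

HB.instance Definition _ :=
  Choice_isMonomialDef.Build (M * N)%type mul2A mul12 mul21 unit2.
End PairMonomial.

Local Open Scope ring_scope.

(* The tensor algebra over the vector space with basis the walks is the algebra
   of the free monoid over the walks, whose product is the concatenation. *)
Notation tensalg K G := {malg K[{fmonom walk G}]}.

(* Its tensor square, with basis the u (x) v and componentwise product. *)
Notation tensalg2 K G := {malg K[({fmonom walk G} * {fmonom walk G})%type]}.

Section Hopf.
Variables (K : fieldType) (G : digraph).
Notation T := (tensalg K G).
Notation T2 := (tensalg2 K G).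

Definition wgen (w : walk G) : T := << fmu w >>.

Definition wword (s : seq (walk G)) : T := \prod_(w <- s) wgen w.

Definition tens (a b : T) : T2 :=
  \sum_(u <- msupp a) \sum_(v <- msupp b) << a@_u * b@_v *g (u, v) >>.

Definition coprod_gen (w : walk G) : T2 :=
  tens 1 (wgen w) + tens (wgen w) 1 +
  \sum_(c in EAdC w)
     tens (wgen (erase c)) (wword [seq section [::] d | d <- c]).

(* The algebra morphism extending coprod_gen. *)
Definition coprod (x : T) : T2 :=
  \sum_(u <- msupp x) x@_u *: \prod_(w <- (u : seq (walk G))) coprod_gen w.

Definition counit (x : T) : K := x@_(mone : {fmonom walk G}).

(* The product of T composed with f (x) g and with the coproduct. *)
Definition convol (f g : T -> T) (x : T) : T :=
  \sum_(p <- msupp (coprod x)) (coprod x)@_p *: (f << p.1 >> * g << p.2 >>).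

Definition is_antipode (S : {linear T -> T}) : Prop :=
  forall x : T, convol S idfun x = counit x *: 1 /\
                convol idfun S x = counit x *: 1.

Definition Tterm (w : walk G) (e : seq (cut w)) : T :=
  wword (erase e :: rev (sections [::] e)).

End Hopf.

(* Main.v *)
Require Import Defs.
From HB Require Import structures.
From mathcomp Require Import all_boot all_order all_algebra finmap zify.
From mathcomp.multinomials Require Import monalg.
Import GRing.Theory.
Local Open Scope ring_scope.

(** The left convolution equation determines the antipode on walks:
    [S w = - w - sum_c S(w_c) w^c], where [c] ranges over the extended admissible
    cuts of [w].  The admissible cuts of [w_c] are those of [w] whose last
    position survives the erasure of [c], so by induction on the length of [w]
    the right-hand side is a signed sum over the pairs [(c, e)] of a word of
    disjoint cuts and a time chain [e] of cuts surviving [c]; the corresponding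
    tensor depends only on the sequence [rev c ++ e] of successive erasures.
    Moving the first cut of [e] to the front of [c], when it lies before all of
    [c], preserves this sequence and changes the sign.  What is left are the
    pairs where [c] is a single cut preceding [e] in time, that is, the
    nonempty time chains. *)

Set Implicit Arguments.
Unset Strict Implicit.
Unset Printing Implicit Defensive.

Local Open Scope nat_scope.

(* Instances of [c.1] and [c.2] differing in their type arguments are distinct
   atoms for [lia] until these are simplified. *)
Ltac slia := simpl in *; lia.

(** Half-open, because the base point of an erased loop is kept at its first position; this is the
    test negated in [remains]. *)
Definition kills {G : digraph} {w : walk G} (c : cut w) (i : 'I_(size w)) :=
  c.1 < i <= c.2.

(** * Lawler's erased loops as a laminar family *)

Section LoopErasure.
Variables (G : digraph) (w : walk G).
Implicit Types (c d : cut w) (i j k l : 'I_(size w)).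

(* The loop-erased walk just before time [i] consists of the positions not killed
   by a loop closed before [i].  This recursion on [i] determines [LES w]. *)
Lemma LES_rec k i : ((k, i) \in LES w) =
  [&& k < i, vtx k == vtx i &
      [forall c in LES w, (c.2 < i) ==> ~~ kills c k]].
Proof.
move: k i; pose E (L : seq (cut w)) k i := [&& k < i, vtx k == vtx i &
      all (fun c => (c.2 < i) ==> ~~ kills c k) L].
pose inv n (st : seq 'I_(size w) * seq (cut w)) :=
  [/\ sorted (fun k l : 'I_(size w) => k < l) st.1,
      forall k, (k \in st.1) = (k < n) && all (fun c => ~~ kills c k) st.2,
      {in st.2, forall c, c.2 < n} &
      forall k i, i < n -> ((k, i) \in st.2) = E st.2 k i].
have ltT : transitive (fun k l : 'I_(size w) => k < l).
  by move=> x y z; apply: ltn_trans.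
have step i st : inv i st -> inv i.+1 (lawler_step st i).
  case: st => p L [/= sp pE Li LE].
  have pi k' : (k' \in p) && (vtx k' == vtx i) = E L k' i.
    rewrite pE /E; case: (k' < i) => //=; rewrite andbC; congr (_ && _).
    by apply: eq_in_all => c /Li ->.
  case F: [seq k <- p | vtx k == vtx i] => [|k0 q].
    have F0 k' : E L k' i = false.
      rewrite -pi andbC; have : k' \in [seq k <- p | vtx k == vtx i] = false by rewrite F.
      by rewrite mem_filter.
    split=> /=.
    - case: p sp pE {F pi} => //= x p xp pE; rewrite rcons_path xp /=.
      by have := pE (last x p); rewrite mem_last => /esym/andP[].
    - move=> k'; rewrite mem_rcons inE pE ltnS; case: eqVneq => [->|ki] /=.
        rewrite leqnn /=; apply/esym/allP => c /Li; rewrite /kills /=; lia.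
      by congr (_ && _); have : (k' : nat) != i by []; lia.
    - by move=> c /Li /ltnW.
    - move=> k' j; rewrite ltnS leq_eqVlt => /predU1P[/val_inj->|]; last exact: LE.
      by rewrite F0; apply/negbTE/negP => /Li /=; rewrite ltnn.
  have : k0 \in [seq k <- p | vtx k == vtx i] by rewrite F mem_head.
  rewrite mem_filter => /andP[/eqP ki kp].
  have [ki_lt kalive] : k0 < i /\ {in L, forall c, ~~ kills c k0}.
    by have := kp; rewrite pE => /andP[-> /allP].
  have tE l : (l \in take (index k0 p).+1 p) = (l \in p) && (l <= k0).
    have ip : index k0 p < size p by rewrite index_mem.
    have -> : (l \in p) = (l \in take (index k0 p).+1 p) ||
        (l \in drop (index k0 p).+1 p).
      by rewrite -mem_cat cat_take_drop.
    have := sp; rewrite -{1}(cat_take_drop (index k0 p).+1 p).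
    rewrite (take_nth k0) // nth_index //.
    rewrite sorted_pairwise // pairwise_cat -cats1 pairwise_cat.
    rewrite mem_cat inE; case/and3P=> /allrelP h1 /and3P[/allrelP h2 _ _] _.
    case: (boolP (l \in take _ _)) => [lt|_] /=.
      by have := h2 l k0 lt; rewrite inE eqxx => /(_ isT) /ltnW.
    case: eqVneq => [->|lk] /=; first by rewrite leqnn.
    case: (boolP (l \in drop _ _)) => //= ld; apply/esym/negbTE; rewrite -ltnNge.
    by apply: h1 => //; rewrite mem_cat mem_head orbT.
  have uniqk l : E L l i -> l = k0.
    rewrite -pi => /andP[lp /eqP lv]; apply/val_inj/eqP; rewrite eqn_leq.
    (* Live positions carry distinct vertices: of two with the same vertex, the later one would have
       closed a loop based at the earlier one and been killed by it. *)
    have aux a b : a \in p -> b \in p -> vtx a = vtx b -> a <= b.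
      move=> ap; rewrite pE => /andP[bi /allP bL] ab; rewrite leqNgt; apply/negP => ba.
      have ai : a < i by have := ap; rewrite pE => /andP[].
      have : (b, a) \in L.
        rewrite LE // /E ba ab eqxx /=; apply/allP => c /bL ->.
        by rewrite implybT.
      by move: ap; rewrite pE => /andP[_ /allP h] /h; rewrite /kills /= ba leqnn.
    by rewrite !aux // lv ki.
  split=> /=.
  - exact: take_sorted.
  - move=> l; rewrite tE pE all_rcons ltnS /kills /=.
    by case: (all _ L); rewrite ?andbF ?andbT //; lia.
  - move=> c; rewrite mem_rcons inE => /predU1P[->//|/Li /ltnW//].
  - move=> l j; rewrite ltnS leq_eqVlt => /predU1P[/val_inj->|ji].
      have -> : E (rcons L (k0, i)) l i = E L l i.
        by rewrite /E all_rcons /= ltnn.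
      rewrite mem_rcons inE; apply/idP/idP => [/predU1P[[->]|/Li/=]|/uniqk->].
      + by rewrite -pi kp ki eqxx.
      + by rewrite ltnn.
      + by rewrite eqxx.
    rewrite mem_rcons inE; case: eqP => [[_ ji']|_]; first by rewrite ji' ltnn in ji.
    rewrite /= LE // /E all_rcons /=.
    by rewrite (ltnNge i j) (ltnW ji).
suff : inv (size w) (lawler w).
  have LESE c : (c \in LES w) = (c \in (lawler w).2) by rewrite inE.
  case=> _ _ _ h k i; rewrite LESE h ?ltn_ord //; congr [&& _, _ & _].
  by apply/allP/forall_inP => hL c cL; apply: hL; rewrite LESE in cL *.
rewrite /lawler.
have fold s n st : map val s = iota n (size s) -> inv n st ->
    inv (n + size s) (foldl (@lawler_step G w) st s).
  elim: s n st => [|j s IHs] n st /=; first by rewrite addn0.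
  case=> ji js ist; rewrite addnS -addSn; apply: IHs; rewrite // -ji.
  by apply: step; rewrite ji.
have := fold (enum 'I_(size w)) 0 ([::], [::]); rewrite size_enum_ord add0n.
by apply; [rewrite val_enum_ord | split].
Qed.

(** If [(a, i)] and [(b, i)] were loops with [a < b], no loop closed before [b] would kill [a], so
    [LES_rec] would yield the loop [(a, b)], which kills [b] before time [i]. *)
Lemma LES_end_inj c d : c \in LES w -> d \in LES w -> c.2 = d.2 -> c = d.
Proof.
have aux (a b i : 'I_(size w)) : (a, i) \in LES w -> (b, i) \in LES w -> b <= a.
  move=> aiL; rewrite LES_rec => /and3P[bi /eqP bv /forall_inP bL].
  have := aiL; rewrite LES_rec => /and3P[ai /eqP av /forall_inP aL].
  rewrite leqNgt; apply/negP => ab.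
  have /bL : (a, b) \in LES w.
    rewrite LES_rec ab av bv eqxx /=; apply/forall_inP => f fL; apply/implyP => fb.
    by have /implyP := aL _ fL; apply; apply: ltn_trans bi.
  by rewrite /= bi /kills /= ab leqnn.
case: c d => [a i] [b j] /= aL bL ij; rewrite -ij in bL *.
by congr pair; apply/val_inj/eqP; rewrite eqn_leq (aux _ _ _ aL bL) (aux _ _ _ bL aL).
Qed.

Lemma LES_laminar c d : c \in LES w -> d \in LES w -> c.2 < d.2 ->
  (c.2 < d.1) || (d.1 <= c.1).
Proof.
move=> cL dL cd; have := LES_nested dL cL; lia.
Qed.

(* Lawler's procedure keeps the base point of an erased loop at its first
   position, so no loop starts at the end of another one. *)
Lemma LES_end_neq_start c d : c \in LES w -> d \in LES w -> c.2 != d.1 :> nat.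
Proof.
move=> cL dL; have := LES_nested dL cL; have := LES_lt cL; have := LES_lt dL; lia.
Qed.

(** Distinct loops have distinct ends, and the one closing first lies before the other or inside it;
    so the time order only compares ends. *)
Lemma time_ltE c d : c \in LES w -> d \in LES w -> time_lt c d = (c.2 < d.2).
Proof.
move=> cL dL; rewrite /time_lt /time_le.
have [->|cd] := eqVneq c d; first by rewrite ltnn.
have : c.2 != d.2 :> nat by apply: contra cd => /eqP/val_inj/(LES_end_inj cL dL)/eqP.
have := LES_laminar cL dL; have := LES_lt cL; have := LES_lt dL; lia.
Qed.

(** By [LES_end_neq_start], the boundary case [c.2 = d.1] allowed by [remains] does not occur. *)
Lemma subLES_remains_end s c : {subset s <= LES w} -> c \in LES w ->
  remains s c.2 = all (fun d => (c.2 < d.1) || (d.2 < c.2)) s.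
Proof.
move=> sL cL; rewrite /remains -all_predC; apply: eq_in_all => d /sL dL /=.
have := LES_end_neq_start cL dL; move=> h; slia.
Qed.

End LoopErasure.

Lemma sorted_enum_ord n (P : pred 'I_n) :
  sorted (fun i j : 'I_n => i < j) (enum P).
Proof.
rewrite {1}/enum_mem sorted_filter //; first by move=> x y z; apply: ltn_trans.
by have := iota_ltn_sorted 0 n; rewrite -val_enum_ord sorted_map enumT.
Qed.

(** * Admissible cuts as the longest loops at their base point *)

Section AdmissibleCuts.
Variables (G : digraph) (w : walk G).
Implicit Types (c d : cut w) (i j k l : 'I_(size w)) (s e : seq (cut w)).

Lemma size_restr (P : pred 'I_(size w)) : size (restr P) = #|P|.
Proof. by rewrite size_map -cardE. Qed.

Lemma eq_restr (P Q : pred 'I_(size w)) : P =1 Q -> restr P = restr Q.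
Proof. by move=> PQ; rewrite /restr (eq_enum PQ). Qed.

Lemma restrT : restr (@predT 'I_(size w)) = w.
Proof.
have -> : restr (@predT 'I_(size w)) = map (tnth (in_tuple w)) (enum 'I_(size w)).
  by congr map; apply: eq_enum.
by rewrite map_tnth_enum.
Qed.

(** Equality of walks compares vertices only, but a section of full length leaves out no
    position. *)
Lemma section_full c : c \in LES w ->
  (section [::] c == w) = [forall i, within c i].
Proof.
move=> cL; rewrite -val_eqE /= val_section //.
rewrite (@eq_restr _ (within c)); last by move=> i; rewrite /= andbT.
apply/eqP/forallP => [E i|full]; last first.
  by rewrite -[RHS]restrT; apply: eq_restr => i; rewrite full.
have cardE : #|within c| = #|'I_(size w)|.
  by have := size_restr (within c); rewrite E card_ord.
by have /(_ i) := elimT (subset_cardP cardE) (subset_predT _); rewrite !unfold_in.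
Qed.

(* If [w_k] recurs before its smallest container closes, then its first
   recurrence closes a longer loop based at [k]. *)
Lemma AdCE c : (c \in AdC w) =
  [&& c \in LES w, ~~ [forall i, within c i] &
      [forall d in LES w, (d.1 == c.1) ==> (d.2 <= c.2)]].
Proof.
rewrite inE; case: (boolP (c \in LES w)) => //= cL.
rewrite section_full //; congr (_ && _).
have contE d : (d \in containers c) = [&& d \in LES w, d.1 <= c.1 & c.2 < d.2].
  by rewrite !inE.
apply/orP/forall_inP => [adm d dL|maxc].
  apply/implyP => /eqP dc; rewrite leqNgt; apply/negP => cd.
  have dcont : d \in containers c by rewrite contE dL dc leqnn cd.
  case: adm => [/eqP c0|]; first by rewrite c0 inE in dcont.
  case/existsP => f /andP[/andP[fcont /forall_inP/(_ _ dcont)/andP[df1 _]]].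
  move: fcont; rewrite contE => /and3P[fL f1 f2] /forallP/(_ f.2).
  rewrite f2 leqnn /= -(LES_vtx fL) => /eqP[]; congr vtx; apply/val_inj/eqP.
  by rewrite eqn_leq f1 -dc df1.
have [_|/set0Pn[d0 d0c]] := eqVneq (containers c) set0; [by left|right].
(* The first container to close; by nesting it also starts last, so it is the smallest. *)
pose d := [arg min_(d < d0 in containers c) (d.2 : nat)].
have [dcont dmin] : d \in containers c /\
    {in containers c, forall f : cut w, d.2 <= f.2}.
  by rewrite /d; case: arg_minnP.
have := dcont; rewrite contE => /and3P[dL d1 d2].
have cd1 : c.1 != d.1 :> nat.
  apply/negP => /eqP/val_inj cd; have := maxc _ dL.
  by rewrite cd eqxx leqNgt d2.
have c12 := LES_lt cL.
apply/existsP; exists d; apply/andP; split.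
  rewrite /smallest_container dcont; apply/forall_inP => f fcont.
  rewrite (dmin _ fcont) andbT leqNgt; apply/negP => df.
  have := fcont; rewrite contE => /and3P[fL f1 f2].
  have f2d : f.2 <= d.2 by apply: (LES_nested fL dL); slia.
  have /(LES_end_inj fL dL) fd : f.2 = d.2.
    by apply/val_inj/eqP; rewrite eqn_leq f2d dmin.
  by move: df; rewrite fd ltnn.
apply/forallP => i; apply/implyP => /andP[ci id]; apply/eqP => vi.
have := maxc (c.1, i); rewrite /= eqxx /= leqNgt ci => /(_ _)/negP; apply=> //.
rewrite LES_rec vi eqxx (ltn_trans c12 ci) /=.
(* A loop killing [c.1] before time [i] would contain [c] and close before [d], against the choice
   of [d]. *)
apply/forall_inP => f fL; apply/implyP => fi; apply/negP; rewrite /kills => fk.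
have f2c : c.2 <= f.2 by apply: (LES_nested cL fL); slia.
have f2c' : f.2 != c.2.
  by apply/eqP => /(LES_end_inj fL cL) fc; move: fk; rewrite fc ltnn.
have := dmin f; rewrite contE fL -val_eqE /= in f2c' *; slia.
Qed.

Lemma AdC_LES : {subset AdC w <= LES w}.
Proof. by move=> c; rewrite AdCE => /and3P[]. Qed.

Lemma all_AdC_LES e : all (mem (AdC w)) e -> {subset e <= LES w}.
Proof. by move=> /allP eA c /eA/AdC_LES. Qed.

(** Comparison of ends is transitive, so the chain condition holds pairwise and splits along
    concatenations. *)
Lemma time_chainE e : time_chain e =
  all (mem (AdC w)) e && pairwise (fun c d => c.2 < d.2) e.
Proof.
rewrite /time_chain; case: (boolP (all _ e)) => //= /all_AdC_LES eL.
rewrite -sorted_pairwise; last by move=> c d f; apply: ltn_trans.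
apply: (@eq_in_sorted _ (mem (LES w))); first exact: time_ltE.
by apply/allP.
Qed.

End AdmissibleCuts.

(** * Loops of the remainder seen inside the original walk *)

Section Embedding.
Variables (G : digraph) (w v : walk G) (s : seq (cut w)).
(** [v] stands for [erase s] and [phi] for the inclusion of its positions, known only through
    [phi_lt], [phi_vtx] and [phi_codom]; [erase_embedding] supplies it. *)
Variable phi : 'I_(size v) -> 'I_(size w).
Hypothesis sL : {subset s <= LES w}.
Hypothesis phi_lt : {mono phi : i j / i < j >-> (i < j)%N}.
Hypothesis phi_vtx : forall i, vtx (phi i) = vtx i.
Hypothesis phi_codom : forall j, remains s j = (j \in codom phi).

Definition emb (c : cut v) : cut w := (phi c.1, phi c.2).

Lemma phi_le i j : (phi i <= phi j) = (i <= j).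
Proof. by rewrite leqNgt phi_lt -leqNgt. Qed.

Lemma phi_inj : injective phi.
Proof.
by move=> i j ij; apply/val_inj/eqP; rewrite eqn_leq -!phi_le ij leqnn.
Qed.

Lemma emb_inj : injective emb.
Proof. by case=> a b [a' b'] [/phi_inj-> /phi_inj->]. Qed.

Lemma phi_remains i : remains s (phi i).
Proof. by rewrite phi_codom codom_f. Qed.

Lemma kills_emb c i : kills (emb c) (phi i) = kills c i.
Proof. by rewrite /kills /= phi_lt phi_le. Qed.

Lemma within_emb c i : within (emb c) (phi i) = within c i.
Proof. by rewrite /within /= !phi_le. Qed.

(** A loop of [s] killing the start of [d] contains [d] by nesting, so it kills the end as well. *)
Lemma embP d : d \in LES w -> remains s d.2 -> exists c, d = emb c.
Proof.
move=> dL d2.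
have d1 : remains s d.1.
  apply/hasPn => f fs; apply/negP => fd.
  have df := LES_nested dL (sL fs) fd; have := LES_lt dL.
  move/hasPn/(_ _ fs): d2; slia.
move: d1 d2; rewrite !phi_codom => /codomP[a da] /codomP[b db].
by exists (a, b); rewrite /emb -da -db; case: (d).
Qed.

(** Induction on the end of the loop through [LES_rec]. A loop of [w] killing a surviving position
    comes from [v], because its end survives: a member of [s] killing that end would start inside
    the loop, share its end by nesting, hence be the loop itself and kill the position. *)
Lemma LES_emb c : (emb c \in LES w) = (c \in LES v).
Proof.
case: c => k i; have [n] := ubnP (i : nat).
elim: n k i => // n IH k i; rewrite ltnS => ni.
rewrite !LES_rec /= phi_lt !phi_vtx; congr [&& _, _ & _].
apply/forall_inP/forall_inP => h c cL; apply/implyP => ci.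
  have := h (emb c); rewrite /= phi_lt ci kills_emb; apply.
  by case: c cL ci => a b cL bi; rewrite IH // (leq_trans bi ni).
apply/negP => ck.
have [|c' cE] := embP cL.
  apply/hasPn => d ds; apply/negP => dc.
  have := phi_remains k => /hasPn/(_ _ ds) dk; move: ck; rewrite /kills => ck.
  have dc2 : d.2 <= c.2 by apply: (LES_nested (sL ds) cL); slia.
  have /(LES_end_inj (sL ds) cL) dcE : d.2 = c.2 by apply/val_inj; slia.
  by move: dk; rewrite dcE; slia.
move: cL ck ci; rewrite cE kills_emb phi_lt => cL ck ci.
suff /h : c' \in LES v by rewrite ci ck.
by case: c' ci cL {cE ck} => a b bi; rewrite -IH // (leq_trans bi ni).
Qed.

Lemma AdC_emb c : (emb c \in AdC w) = (c \in AdC v).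
Proof.
rewrite !AdCE LES_emb; case: (boolP (c \in LES v)) => //= cL.
have cL' : emb c \in LES w by rewrite LES_emb.
congr (~~ _ && _); apply/idP/idP.
- by move/forallP=> h; apply/forallP => i; rewrite -within_emb.
- move/forallP => h.
  (* Descent: a position after the end of [c] cannot survive, as [c] covers [v]; the loop of [s]
     killing it starts earlier, but still after the end of [c]. *)
  have out (j : 'I_(size w)) : (emb c).2 < j -> False.
    have [n] := ubnP (j : nat); elim: n j => // n IH j; rewrite ltnS => jn cj.
    case: (boolP (remains s j)) => [|/negPn/hasP[d ds dj]].
      rewrite phi_codom => /codomP[i ji]; have := h i.
      by rewrite -within_emb -ji /within leqNgt => /andP[_]; rewrite leqNgt cj.
    have /hasPn/(_ _ ds) := phi_remains c.2.
    have := LES_end_neq_start cL' (sL ds) => cd cd2.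
    by apply: (IH d.1); slia.
  apply/forallP => j; rewrite /within [j <= _]leqNgt andbC.
  case: (boolP (_ < j)) => [/out//|_] /=.
  (* Position 0 survives every erasure, so [c] must start there. *)
  have w_gt0 : 0 < size w by apply: leq_ltn_trans (ltn_ord j).
  have : remains s (Ordinal w_gt0) by apply/hasPn => d _; rewrite ltn0.
  rewrite phi_codom => /codomP[i i0]; have := h i; rewrite -within_emb -i0 /within.
  by case/andP; rewrite /= leqn0 => /eqP->.
- move/forall_inP => h; apply/forall_inP => d dL; apply/implyP => /eqP dc.
  by have := h (emb d); rewrite LES_emb /= dc eqxx phi_le; apply.
- move/forall_inP => h; apply/forall_inP => d dL; apply/implyP => /eqP /= dc.
  rewrite leqNgt; apply/negP => cd.
  (* The end of [d] survives: a member of [s] killing it but sparing the end of [c] would coincide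
     with [d], which kills the end of [c]. *)
  have [|d' dE] := embP dL.
    apply/hasPn => f fs; apply/negP => fd.
    have /hasPn/(_ _ fs) := phi_remains c.2 => fc.
    have c12 := LES_lt cL'.
    have ffd : f.2 <= d.2 by apply: (LES_nested (sL fs) dL); rewrite dc; slia.
    have /(LES_end_inj (sL fs) dL) fdE : f.2 = d.2 by apply/val_inj; slia.
    by move: fc; rewrite fdE dc; slia.
  have := h d'; move: dL dc cd; rewrite dE LES_emb /= => dL /phi_inj-> cd.
  by rewrite dL eqxx leqNgt -phi_lt cd => /(_ isT).
Qed.

Lemma time_chain_emb e : time_chain (map emb e) = time_chain e.
Proof.
rewrite !time_chainE all_map pairwise_map; congr (_ && _).
  by apply: eq_all => c /=; rewrite AdC_emb.
by apply: eq_pairwise => c d /=; rewrite phi_lt.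
Qed.

Lemma surviving_chain_emb d : time_chain d -> all (fun c => remains s c.2) d ->
  exists e, d = map emb e.
Proof.
rewrite time_chainE => /andP[/all_AdC_LES dL _].
elim: d dL => [|d t IH] dL /=; first by exists [::].
case/andP=> dr /IH[]; first by move=> c ct; apply: dL; rewrite inE ct orbT.
have [||c ->] := @embP d; rewrite ?dL ?mem_head // => e ->.
by exists (c :: e).
Qed.

Lemma restr_emb (P : pred 'I_(size w)) (Q : pred 'I_(size v)) :
  (forall i, P (phi i) = Q i) -> (forall j, P j -> remains s j) ->
  restr P = restr Q.
Proof.
move=> PQ Ps; rewrite /restr.
have -> : enum P = map phi (enum Q).
  apply: (irr_sorted_eq (leT := fun i j : 'I_(size w) => i < j)).
  - by move=> x y z; apply: ltn_trans.
  - by move=> x; rewrite ltnn.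
  - exact: sorted_enum_ord.
  - by rewrite sorted_map (eq_sorted (e' := fun i j : 'I_(size v) => i < j)) //
            sorted_enum_ord.
  move=> j; rewrite mem_enum; apply/idP/mapP => [Pj|[i]].
    have := Ps _ Pj; rewrite phi_codom => /codomP[i ji]; exists i => //.
    by rewrite mem_enum -topredE /= -PQ -ji.
  by rewrite mem_enum => Qi ->; rewrite -topredE /= PQ.
by rewrite -map_comp; apply: eq_map => i /=; rewrite phi_vtx.
Qed.

(** Erasure depends only on the set of cuts; [s'] will be [rev s], since words of disjoint cuts are
    erased from right to left. *)
Variable s' : seq (cut w).
Hypothesis ss' : s' =i s.

Lemma remains_cat_emb t i : remains (s' ++ map emb t) (phi i) = remains t i.
Proof.
rewrite /remains has_cat (eq_has_r ss') has_map negb_or.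
have := phi_remains i; rewrite /remains => -> /=.
by congr negb; apply: eq_has => c /=; rewrite phi_le phi_lt.
Qed.

Lemma remains_catl t j : remains (s' ++ t) j -> remains s j.
Proof. by rewrite /remains has_cat (eq_has_r ss') negb_or => /andP[]. Qed.

Lemma erase_cat_emb (t : seq (cut v)) : {subset t <= LES v} ->
  erase (s' ++ map emb t) = erase t.
Proof.
move=> tL; have := val_erase tL.
rewrite /erase => vE; apply/val_inj; rewrite vE val_insubd.
have E : restr (remains (s' ++ map emb t)) = restr (remains t).
  by apply: restr_emb; [apply: remains_cat_emb | apply: remains_catl].
(* The sequence is the value of a walk, so [insubd] does not return its default, which differs
   between [w] and [v]. *)
by rewrite E -vE valP.
Qed.

Lemma section_cat_emb (t : seq (cut v)) (c : cut v) :
  {subset t <= LES v} -> c \in LES v ->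
  all (fun d : cut v => d.2 < c.2) t ->
  section (s' ++ map emb t) (emb c) = section t c.
Proof.
move=> tL cL tc; have := val_section tL cL.
have -> : all (fun d => time_le d c) t.
  apply/allP => d dt; have := allP tc _ dt; rewrite -(time_ltE (tL _ dt) cL).
  by case/andP.
move=> /(_ isT); rewrite /section => vE; apply/val_inj; rewrite vE val_insubd.
have E : restr (predI (within (emb c)) (remains (s' ++ map emb t))) =
         restr (predI (within c) (remains t)).
  apply: restr_emb => [i|j] /=; first by rewrite within_emb remains_cat_emb.
  by case/andP=> _; apply: remains_catl.
by rewrite E -vE valP.
Qed.

Lemma sections_cat_emb t e : time_chain (t ++ e) ->
  sections (s' ++ map emb t) (map emb e) = sections t e.
Proof.
elim: e t => [//|c e IH] t te /=; congr cons; last first.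
  by rewrite rcons_cat -map_rcons IH // cat_rcons.
move: te; rewrite time_chainE => /andP[/all_AdC_LES teL].
rewrite pairwise_cat allrel_consr => /and3P[/andP[tc _] _ _].
apply: section_cat_emb => // [d dt|]; apply: teL.
  by rewrite mem_cat dt.
by rewrite mem_cat mem_head orbT.
Qed.

End Embedding.

(** [phi] enumerates the surviving positions increasingly; the cast turns an index in [erase s] into
    a rank among them. *)
Lemma erase_embedding (G : digraph) (w : walk G) (s : seq (cut w)) :
  {subset s <= LES w} ->
  exists phi : 'I_(size (erase s)) -> 'I_(size w),
    [/\ {mono phi : i j / i < j >-> (i < j)%N},
        forall i, vtx (phi i) = vtx i &
        forall j, remains s j = (j \in codom phi)].
Proof.
move=> sL; have vE := val_erase sL.
have szE : size (erase s) = #|remains s| by rewrite [walk_seq _]vE size_restr.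
pose phi i := enum_val (cast_ord szE i).
exists phi; split.
- move=> i j; have x0 : 'I_(size w) := phi i.
  rewrite /phi !(enum_val_nth x0) /=.
  have : sorted ltn (map val (enum (remains s))).
    by rewrite sorted_map sorted_enum_ord.
  move=> srt; have iS : i < size (enum (remains s)) by rewrite -cardE -szE.
  have jS : j < size (enum (remains s)) by rewrite -cardE -szE.
  rewrite -!(nth_map x0 0 val) //.
  apply/idP/idP; last by apply: (sorted_ltn_nth ltn_trans 0 srt); rewrite inE size_map.
  rewrite ltnNge => h; rewrite ltnNge; apply: contra h; rewrite leq_eqVlt.
  case/predU1P => [->//|ji]; apply: ltnW.
  by apply: (sorted_ltn_nth ltn_trans 0 srt); rewrite ?inE ?size_map.
- move=> i; have x0 : G := vtx i; have y0 : 'I_(size w) := phi i.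
  have nthE n : n < #|remains s| ->
      nth x0 (erase s) n = vtx (nth y0 (enum (remains s)) n).
    by move=> ns; rewrite [walk_seq _]vE /restr (nth_map y0) // -cardE.
  rewrite /phi (enum_val_nth y0) /= [RHS](tnth_nth x0) /= nthE //.
  by rewrite -szE.
move=> j; apply/idP/codomP => [jr|[i ->]]; last first.
  by have := enum_valP (cast_ord szE i); rewrite unfold_in.
have jr' : j \in remains s by rewrite unfold_in.
exists (cast_ord (esym szE) (enum_rank_in jr' j)).
by rewrite /phi cast_ordKV enum_rankK_in.
Qed.

Lemma big_seq_bij (V : nmodType) (I J : eqType) (h : I -> J) (r : seq I)
    (r' : seq J) (F : J -> V) :
  uniq r -> uniq r' -> {in r &, injective h} -> r' =i map h r ->
  (\sum_(y <- r') F y = \sum_(x <- r) F (h x))%R.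
Proof.
move=> ur ur' hinj rr'; rewrite -(big_map h xpredT F); apply: perm_big.
by apply: uniq_perm => //; rewrite map_inj_in_uniq.
Qed.

(** * Words of disjoint cuts, time chains and their cancellation *)

Section Words.
Variables (G : digraph) (w : walk G).
Implicit Types (c d : cut w) (s e : seq (cut w)).

Definition cut_before c d := c.2 < d.1.

Definition cut_words : seq (seq (cut w)) := [seq val t | t <- enum (EAdC w)].
Definition chains : seq (seq (cut w)) := [seq val t | t <- enum (TAdC w)].

Lemma cut_words_uniq : uniq cut_words.
Proof. by rewrite map_inj_uniq ?enum_uniq //; apply: val_inj. Qed.

Lemma chains_uniq : uniq chains.
Proof. by rewrite map_inj_uniq ?enum_uniq //; apply: val_inj. Qed.

Lemma uniq_AdC_size s : uniq s -> all (mem (AdC w)) s -> size s <= #|AdC w|.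
Proof.
by move=> us /allP sA; rewrite -(card_uniqP us); apply/subset_leq_card/subsetP.
Qed.

Lemma time_chain_size e : time_chain e -> size e <= #|AdC w|.
Proof.
rewrite time_chainE => /andP[eA ep]; apply: uniq_AdC_size => //.
by apply: (pairwise_uniq _ ep) => c /=; rewrite ltnn.
Qed.

Lemma mem_chains e : (e \in chains) = (e != [::]) && time_chain e.
Proof.
apply/mapP/idP => [[t]|/andP[e0 ec]]; first by rewrite mem_enum inE => ? ->.
by exists (Bseq (time_chain_size ec)); rewrite // mem_enum inE e0.
Qed.

Lemma mem_cut_words s : (s \in cut_words) =
  [&& s != [::], all (mem (AdC w)) s & pairwise cut_before s].
Proof.
have pE : all (mem (AdC w)) s -> sorted cut_before s = pairwise cut_before s.
  move=> sA; apply: (@sorted_pairwise_in _ (mem (LES w))); last exact/allP/all_AdC_LES.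
  (* Transitivity rests on the middle cut starting before it ends. *)
  move=> d c f dL _ _; rewrite /cut_before => cd df; have := LES_lt dL; slia.
apply/mapP/idP => [[t]|/and3P[s0 sA sp]].
  rewrite mem_enum inE => /and3P[t0 tA tp] sE; rewrite sE in pE *.
  by rewrite t0 tA -pE.
have sz : size s <= #|AdC w|.
  apply: uniq_AdC_size => //; have := sA => /all_AdC_LES.
  elim: s sp {pE s0 sA} => //= c s IH.
  case/andP=> /allP cs sp sL; rewrite IH // ?andbT => [|d ds]; last first.
    by apply: sL; rewrite inE ds orbT.
  apply/negP => /cs; rewrite /cut_before.
  by have := LES_lt (sL c (mem_head _ _)); slia.
by exists (Bseq sz); rewrite // mem_enum inE s0 sA pE.
Qed.

Definition survives s e := all (fun c => remains s c.2) e.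

(** Index set of the expanded antipode recursion: [e] stands for a chain of [erase s], the empty one
    accounting for the term [erase s] itself. *)
Definition splittings : seq (seq (cut w) * seq (cut w)) :=
  [seq (s, e) | s <- cut_words, e <- [seq e <- [::] :: chains | survives s e]].

Lemma splittings_uniq : uniq splittings.
Proof.
apply: allpairs_uniq_dep; first exact: cut_words_uniq.
  by move=> s _; rewrite filter_uniq //= chains_uniq mem_chains.
by move=> [s e] [s' e'] _ _ [-> ->].
Qed.

(** For loops of [w] this means that [c] is neither [d] nor nested in it, which is what survival of
    the end of [c] amounts to. *)
Definition apart c d := (c.2 < d.1) || (d.2 < c.2).

Lemma mem_splittings s e : ((s, e) \in splittings) =
  [&& s != [::], all (mem (AdC w)) s, pairwise cut_before s,
      all (mem (AdC w)) e, pairwise (fun c d => c.2 < d.2) e &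
      allrel apart e s].
Proof.
have -> : ((s, e) \in splittings) =
    [&& s \in cut_words, time_chain e & survives s e].
  apply/allpairsPdep/and3P => [[s' [e' [ss' + [-> ->]]]]|[sw ec es]].
    rewrite mem_filter inE mem_chains => /andP[-> /predU1P[->//|/andP[_ ->]]].
    by [].
  exists s, e; split=> //; rewrite mem_filter es inE mem_chains ec andbT.
  by case: eqP.
rewrite mem_cut_words time_chainE.
case: (s != [::]) => //=; case: (boolP (all _ s)) => //= /all_AdC_LES sL.
case: (pairwise _ s) => //=; case: (boolP (all _ e)) => //= /all_AdC_LES eL.
congr (_ && _); apply: eq_in_all => c ce.
by rewrite subLES_remains_end // eL.
Qed.

Definition shiftable (p : seq (cut w) * seq (cut w)) :=
  if p is (d :: _, c :: _) then cut_before c d else false.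

(** Preserves [rev p.1 ++ p.2] and shortens a nonempty chain by one, which flips the sign. *)
Definition shift (p : seq (cut w) * seq (cut w)) :=
  if p.2 is c :: e then (c :: p.1, e) else p.

(** The inverse moves the first cut [c] of the word back to the chain. If the chain starts with [f],
    non-shiftability forbids [f] to lie before [c], and survival then makes [f] close after [c], so
    [c :: e] is a chain. Conversely, in a chain [c :: f :: _] the cut [f] closes after [c], so a
    shifted pair is not shiftable. *)
Lemma mem_shift (p : seq (cut w) * seq (cut w)) :
  (p \in [seq p <- splittings | ~~ shiftable p & 1 < size p.1]) =
  (p \in map shift [seq p <- splittings | shiftable p]).
Proof.
apply/idP/mapP => [|[[[|d s] [|c e]]]]; rewrite !mem_filter // ?andbF //.
  case: p => [[|c [|d s]] e]; rewrite ?andbF // mem_splittings.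
  rewrite !allrel_consr => /andP[/andP[nsh _]].
  case/and5P => _ csA csp eA /and4P[ep ec ed es].
  exists (d :: s, c :: e) => //.
  rewrite mem_filter mem_splittings allrel_consl allrel_consr ed es.
  move: csA csp => /= /and3P[cA dA sA] /and3P[/andP[cd cs] ds sp].
  have cL := AdC_LES cA; have c12 := LES_lt cL.
  rewrite cd dA sA ds sp cA eA ep /=.
  have -> : all (apart c) s.
    by apply/allP => f /(allP cs); rewrite /apart /cut_before => ->.
  rewrite {1}/apart -/(cut_before c d) cd /= !andbT.
  case: e nsh ec ep {eA ed es} => //= f e; rewrite /apart /cut_before.
  move=> nsh /andP[fc _] /andP[/allP fe _].
  have cf : c.2 < f.2 by slia.
  by rewrite cf; apply/allP => g /fe; apply: ltn_trans.
rewrite mem_splittings => /andP[cd].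
move=> /and5P[_ dsA dsp ceA /andP[cep cesr]] ->.
move: (ceA) (cep) => /= /andP[cA eA] /andP[ce ep].
have cL := AdC_LES cA; have c12 := LES_lt cL.
rewrite [shift _]/= mem_splittings /= cA eA ep.
move: (dsA) (dsp) cd => /= /andP[dA sA] /andP[/allP ds sp] cd.
have d12 := LES_lt (AdC_LES dA).
rewrite dA sA sp cd /= !andbT.
move: cesr; rewrite !allrel_consl => /andP[_ der].
have -> : all (cut_before c) s.
  by apply/allP => f /ds; move: cd; rewrite /cut_before; slia.
have -> /= : all (cut_before d) s by apply/allP.
rewrite allrel_consr der andbT; apply/andP; split.
  case: e ce {eA ep der ceA cep} => //= f e /andP[cf _].
  by rewrite /cut_before; slia.
by apply/allP => f /(allP ce); rewrite /apart => ->; rewrite orbT.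
Qed.

Lemma shift_inj : {in [seq p <- splittings | shiftable p] &, injective shift}.
Proof.
move=> [[|d s] [|c e]] [[|d' s'] [|c' e']]; rewrite !mem_filter //=.
by move=> _ _ [-> -> -> ->].
Qed.

(** In the remaining pairs the word is a single cut [c]; survival and non-shiftability then say
    exactly that [c] closes before every cut of [e]. *)
Lemma mem_chain_splitting e :
  (e \in chains) = (e \in map (fun p => rev p.1 ++ p.2)
    [seq p <- splittings | ~~ shiftable p & ~~ (1 < size p.1)]).
Proof.
rewrite mem_chains time_chainE; apply/idP/mapP => [|[[[|c [|d s]] f]]].
- case: e => // c e /= /andP[/andP[cA eA] /andP[ce ep]].
  exists ([:: c], e) => //; rewrite mem_filter mem_splittings /= cA eA ep /=.
  have c12 := LES_lt (AdC_LES cA).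
  rewrite allrel1r andbT; apply/andP; split; last first.
    by apply/allP => f /(allP ce); rewrite /apart => ->; rewrite orbT.
  case: e ce {eA ep} => //= f e /andP[cf _]; rewrite /cut_before; slia.
- by rewrite mem_filter mem_splittings andbF.
- rewrite mem_filter mem_splittings /= allrel1r => /andP[/andP[nsh _]].
  case/and4P=> /andP[cA _] fA fp fc ->; rewrite /= cA fA fp /= !andbT.
  case: f nsh fc fp {fA} => //= d f nsh /andP[dc _] /andP[/allP df _].
  have cd : c.2 < d.2 by move: nsh dc; rewrite /apart /cut_before; slia.
  by rewrite cd; apply/allP => g /df; apply: ltn_trans.
- by rewrite mem_filter /= andbF.
Qed.

Local Open Scope ring_scope.

(** Shiftable pairs cancel against their shifts. The final sign comes from the single cut of the
    word, which [size e] does not count on the left. *)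
Lemma splittings_cancel (K : pzRingType) (V : lmodType K) (F : seq (cut w) -> V) :
  \sum_(s <- cut_words) \sum_(e <- [::] :: chains | survives s e)
     (-1) ^+ size e *: F (rev s ++ e) =
  - \sum_(e <- chains) (-1) ^+ size e *: F e.
Proof.
pose f (p : seq (cut w) * seq (cut w)) := (-1) ^+ size p.2 *: F (rev p.1 ++ p.2).
have -> : \sum_(s <- cut_words) \sum_(e <- [::] :: chains | survives s e)
     (-1) ^+ size e *: F (rev s ++ e) = \sum_(p <- splittings) f p.
  rewrite big_allpairs_dep; apply: eq_bigr => s _.
  by rewrite -[LHS]big_filter.
rewrite (bigID shiftable) /=.
rewrite (bigID (fun p => (1 < size p.1)%N) (fun p => ~~ shiftable p)) /=.
have -> : \sum_(p <- splittings | ~~ shiftable p && (1 < size p.1)%N) f p =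
    - \sum_(p <- splittings | shiftable p) f p.
  rewrite -[LHS]big_filter -[in RHS]big_filter.
  rewrite (big_seq_bij f _ _ shift_inj mem_shift) ?filter_uniq ?splittings_uniq //.
  rewrite -sumrN; apply: eq_big_seq => -[[|d s] [|c e]]; rewrite mem_filter //= => _.
  by rewrite /f /= exprS mulN1r scaleNr opprK rev_cons cat_rcons.
rewrite addrA subrr add0r -[LHS]big_filter.
rewrite (big_seq_bij (fun e => (-1) ^+ size e *: F e) _ _ _ mem_chain_splitting).
- rewrite -sumrN; apply: eq_big_seq => -[[|c [|d s]] e].
  + by rewrite mem_filter mem_splittings andbF.
  + by rewrite /f /= exprS mulN1r scaleNr opprK.
  + by rewrite mem_filter /= andbF.
- by rewrite filter_uniq ?splittings_uniq.
- exact: chains_uniq.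
move=> [[|c [|d s]] e] [[|c' [|d' s']] e'];
  rewrite !mem_filter ?mem_splittings ?andbF //=.
by move=> _ _ [-> ->].
Qed.

End Words.

Local Open Scope ring_scope.

(** * Linear extension from a basis *)

Section LinearExtension.
Variables (K : fieldType) (M : choiceType) (V : lmodType K) (h : M -> V).
Implicit Types g : {malg K[M]}.

(** The common shape to which [coprod] and [convol] unfold. *)
Definition linext g := \sum_(k <- msupp g) g@_k *: h k.

Lemma linextEw (d : {fset M}) g : (msupp g `<=` d)%fset ->
  linext g = \sum_(k <- d) g@_k *: h k.
Proof.
move=> le; rewrite [LHS](big_fset_incl _ le) // => x xd /mcoeff_outdom ->.
by rewrite scale0r.
Qed.

Lemma linextU k : linext << k >> = h k.
Proof. by rewrite (linextEw msuppU_le) big_seq_fset1 mcoeffUU scale1r. Qed.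

Lemma linextD : {morph linext : g1 g2 / g1 + g2}.
Proof.
move=> g1 g2 /=; set d := (msupp g1 `|` msupp g2)%fset.
rewrite (@linextEw d) ?msuppD_le // (@linextEw d) ?fsubsetUl //.
rewrite (@linextEw d g2) ?fsubsetUr // -big_split /=.
by apply: eq_bigr => k _; rewrite mcoeffD scalerDl.
Qed.

Lemma linext0 : linext 0 = 0.
Proof. by rewrite /linext msupp0 big_seq_fset0. Qed.

Lemma linext_sum (I : Type) (r : seq I) (P : pred I) (F : I -> {malg K[M]}) :
  linext (\sum_(i <- r | P i) F i) = \sum_(i <- r | P i) linext (F i).
Proof. exact: (big_morph _ linextD linext0). Qed.

End LinearExtension.

(** * The antipode on walks *)

Section Antipode.
Variables (K : fieldType) (G : digraph).
Notation T := (tensalg K G).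

Lemma malg1E : (1 : T) = << mone >>.
Proof. by []. Qed.

Lemma wword_cat (s t : seq (walk G)) : wword K (s ++ t) = wword K s * wword K t.
Proof. by rewrite /wword big_cat. Qed.

(** Words are single basis elements, so that [tensU] applies to them. *)
Lemma wwordE (s : seq (walk G)) : exists u, wword K s = << u >>.
Proof.
elim: s => [|x s [u su]]; first by exists mone; rewrite /wword big_nil.
exists (mmul (fmu x) u); move: su; rewrite /wword big_cons => ->.
by rewrite malgM_def fgmulUU mulr1.
Qed.

Lemma tensU (u v : {fmonom walk G}) :
  tens (<< u >> : T) << v >> = << (u, v) >>.
Proof. by rewrite /tens !msuppU1 !big_seq_fset1 !mcoeffUU mulr1. Qed.

(** Convolution with an arbitrary tensor in place of the coproduct, hence additive in it. *)
Definition conv (f g : T -> T) : tensalg2 K G -> T :=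
  linext (fun p => f << p.1 >> * g << p.2 >>).

Lemma convolE (f g : T -> T) x : convol f g x = conv f g (coprod x).
Proof. by []. Qed.

Lemma coprodU (u : {fmonom walk G}) : coprod (<< u >> : T) =
  \prod_(w <- (u : seq (walk G))) coprod_gen K w.
Proof.
exact: (linextU (fun u : {fmonom walk G} =>
  \prod_(w <- (u : seq (walk G))) coprod_gen K w)).
Qed.

Lemma conv_tensU (f g : T -> T) (u v : {fmonom walk G}) :
  conv f g (tens << u >> << v >>) = f << u >> * g << v >>.
Proof. by rewrite tensU /conv linextU. Qed.

Lemma conv_coprod_gen (f g : T -> T) (w : walk G) :
  conv f g (coprod_gen K w) = f 1 * g (wgen K w) + f (wgen K w) * g 1 +
    \sum_(s <- cut_words w)
       f (wgen K (erase s)) * g (wword K [seq section [::] d | d <- s]).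
Proof.
rewrite [LHS]linextD [X in X + _]linextD; congr (_ + _ + _).
- exact: (conv_tensU f g mone (fmu w)).
- exact: (conv_tensU f g (fmu w) mone).
rewrite linext_sum /cut_words big_map big_enum /=; apply: eq_bigr => s _.
have [v ->] := wwordE [seq section [::] d | d <- s].
exact: (conv_tensU f g (fmu (erase s)) v).
Qed.

Variables (S : {linear T -> T}) (hS : is_antipode S).

Lemma antipode1 : S 1 = 1.
Proof.
have [] := hS 1; rewrite convolE malg1E coprodU fm1 big_nil.
rewrite (_ : 1 = << mone >>) // /conv linextU /= => + _.
by rewrite -malg1E mulr1 /counit malg1E mcoeffUU scale1r.
Qed.

Lemma antipode_wgen (w : walk G) : S (wgen K w) = - wgen K w -
  \sum_(s <- cut_words w)
     S (wgen K (erase s)) * wword K [seq section [::] d | d <- s].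
Proof.
have [+ _] := hS (wgen K w).
rewrite convolE coprodU fmU big_seq1 conv_coprod_gen.
rewrite [S 1]antipode1 mul1r mulr1.
(* A generator is not the empty word, so its counit vanishes. *)
rewrite /counit mcoeffU1 fm1_eq1 scale0r => E.
apply/eqP; rewrite -subr_eq0 opprB opprK addrC -addrA addrC; apply/eqP.
exact: E.
Qed.

Lemma sections_cat (w : walk G) (s e1 e2 : seq (cut w)) :
  sections s (e1 ++ e2) = sections s e1 ++ sections (s ++ e1) e2.
Proof.
elim: e1 s => [|c e1 IH] s /=; first by rewrite cats0.
by rewrite IH cat_rcons.
Qed.

(** Erasing from right to left, the cuts already erased lie to the right of the current one and
    leave its section intact. *)
Lemma sections_rev (w : walk G) (s : seq (cut w)) :
  pairwise (@cut_before G w) s ->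
  rev (sections [::] (rev s)) = [seq section [::] d | d <- s].
Proof.
elim: s => // c s IH /= /andP[/allP cs /IH sE].
rewrite rev_cons -cats1 sections_cat /= cats1 rev_rcons sE; congr cons.
rewrite /section; congr insubd; apply: eq_restr => i /=.
case: (boolP (within c i)) => //= /andP[_ ic].
apply/hasPn => d; rewrite mem_rev => /cs; rewrite /cut_before; slia.
Qed.

Lemma Tterm_nil (w : walk G) : Tterm K ([::] : seq (cut w)) = wgen K w.
Proof.
rewrite /Tterm /wword big_seq1; congr wgen; apply: val_inj.
by rewrite val_erase // -[RHS]restrT; apply: eq_restr.
Qed.

Lemma size_erase (w : walk G) (s : seq (cut w)) :
  s != [::] -> {subset s <= LES w} -> (size (erase s) < size w)%N.
Proof.
case: s => // c s _ sL; rewrite [walk_seq (erase _)](val_erase sL) size_restr.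
rewrite -[X in (_ < X)%N]card_ord; apply: proper_card; apply/properP; split.
  exact: subset_predT.
exists c.2 => //; rewrite unfold_in /remains /= leqnn andbT.
by rewrite (LES_lt (sL _ (mem_head _ _))).
Qed.

(** [emb phi] matches the chains of [erase s] with the chains of [w] surviving [s]. As [Tterm] lists
    sections backwards, multiplying by the sections of [s] on the right amounts to erasing [rev s]
    first. *)
Lemma Tterm_erase (w : walk G) (s : seq (cut w)) : s \in cut_words w ->
  (\sum_(e <- [::] :: chains (erase s)) (-1) ^+ size e *: Tterm K e) *
     wword K [seq section [::] d | d <- s] =
  \sum_(e <- [::] :: chains w | survives s e)
     (-1) ^+ size e *: Tterm K (rev s ++ e).
Proof.
rewrite mem_cut_words => /and3P[_ /all_AdC_LES sL sp].
have [phi [phi_lt phi_vtx phi_codom]] := erase_embedding sL.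
have chain0 (v : walk G) (e : seq (cut v)) : (e \in [::] :: chains v) = time_chain e.
  by rewrite inE mem_chains; case: eqP => // ->.
have emb_i := emb_inj phi_lt.
have cE := time_chain_emb sL phi_lt phi_vtx phi_codom.
rewrite -[RHS]big_filter.
rewrite (big_seq_bij (h := map (emb phi)) (r := [::] :: chains (erase s))).
- rewrite mulr_suml; apply: eq_big_seq => e; rewrite chain0 => ec.
  rewrite size_map -scalerAl; congr (_ *: _).
  have srs : rev s =i s by move=> d; rewrite mem_rev.
  rewrite /Tterm -wword_cat /=; congr wword; congr cons.
    rewrite (erase_cat_emb phi_lt phi_vtx phi_codom srs) //.
    by move: ec; rewrite time_chainE => /andP[/all_AdC_LES].
  rewrite sections_cat rev_cat sections_rev //=.
  have := sections_cat_emb phi_lt phi_vtx phi_codom srs (t := [::]) ec.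
  by rewrite cats0 => ->.
- by rewrite /= mem_chains chains_uniq.
- by rewrite filter_uniq //= mem_chains chains_uniq.
- by move=> e e' _ _; apply: inj_map.
move=> e; rewrite mem_filter chain0; apply/andP/mapP => [[es ec]|[e']].
  have [e' eE] := surviving_chain_emb sL phi_codom ec es.
  by exists e'; rewrite // chain0 -cE -eE.
rewrite chain0 => ec ->; rewrite cE; split => //.
by rewrite /survives all_map; apply/allP => c _ /=; rewrite (phi_remains phi_codom).
Qed.

(** Induction on the length of [w]. The empty chain is included because its tensor is [w], which
    absorbs the leading term of [antipode_wgen]. *)
Lemma antipode_chains (w : walk G) : S (wgen K w) =
  - \sum_(e <- [::] :: chains w) (-1) ^+ size e *: Tterm K e.
Proof.
have [n] := ubnP (size w); elim: n w => // n IH w; rewrite ltnS => wn.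
rewrite antipode_wgen big_cons /= expr0 scale1r opprD Tterm_nil.
congr (_ + _); rewrite -splittings_cancel -sumrN; apply: eq_big_seq => s sw.
rewrite IH ?mulNr ?opprK ?Tterm_erase //.
move: sw; rewrite mem_cut_words => /and3P[s0 /all_AdC_LES sL _].
exact: leq_trans (size_erase s0 sL) wn.
Qed.

End Antipode.

(** Chains are grouped by length; being strict, they have at most [#|AdC w|] cuts, and nonemptiness
    excludes length 0. *)
Lemma sum_TAdC_size (V : nmodType) (G : digraph) (w : walk G)
    (F : seq (cut w) -> V) :
  \sum_(e in TAdC w) F e =
  \sum_(1 <= n < #|AdC w|.+1) \sum_(c : n.-tuple (cut w) | time_chain c) F c.
Proof.
have -> : \sum_(e in TAdC w) F e = \sum_(e <- chains w) F e.
  by rewrite big_map big_enum.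
pose tuples n := [seq val c | c <- enum [pred c : n.-tuple (cut w) | time_chain c]].
have mem_tuples n e : (e \in tuples n) = (size e == n) && time_chain e.
  apply/mapP/andP => [[c]|[/eqP <- ec]].
    by rewrite mem_enum inE => ? ->; rewrite size_tuple.
  by exists (in_tuple e); rewrite // mem_enum.
have -> : \sum_(1 <= n < #|AdC w|.+1) \sum_(c : n.-tuple (cut w) | time_chain c) F c
    = \sum_(e <- [seq e | n <- index_iota 1 #|AdC w|.+1, e <- tuples n]) F e.
  by rewrite big_allpairs_dep; apply: eq_bigr => n _; rewrite big_map big_enum.
apply: perm_big; apply: uniq_perm; first exact: chains_uniq.
  apply: allpairs_uniq_dep; first exact: iota_uniq.
    by move=> n _; rewrite map_inj_uniq ?enum_uniq //; apply: val_inj.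
  move=> [n e] [n' e'] /allpairsPdep[m [f [_ + [-> ->]]]].
  move=> + /allpairsPdep[m' [f' [_ + [-> ->]]]] /=.
  by rewrite !mem_tuples => /andP[/eqP <- _] /andP[/eqP <- _] ->.
move=> e; rewrite mem_chains; apply/andP/allpairsPdep => [[e0 ec]|].
  exists (size e), e; rewrite mem_index_iota mem_tuples eqxx ec ltnS.
  by rewrite (time_chain_size ec) lt0n size_eq0 e0.
move=> [n [f [+ + ->]]]; rewrite mem_index_iota mem_tuples.
by move=> /andP[n0 _] /andP[/eqP fn ->]; rewrite -size_eq0 fn -lt0n.
Qed.

Theorem mainTheorem10 (K : fieldType) (G : digraph)
    (charK : [pchar K] =i pred0)
    (S : {linear tensalg K G -> tensalg K G}) (hS : is_antipode S)
    (w : walk G) :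
  S (wgen K w) = - wgen K w - \sum_(e in TAdC w) (-1) ^+ size e *: Tterm K e
  /\
  - wgen K w - \sum_(e in TAdC w) (-1) ^+ size e *: Tterm K e
  = - wgen K w - \sum_(1 <= n < #|AdC w|.+1)
                   \sum_(c : n.-tuple (cut w) | time_chain c)
                      (-1) ^+ n *: Tterm K c.
Proof.
split.
  rewrite (antipode_chains hS) big_cons /= expr0 scale1r opprD Tterm_nil.
  by rewrite /chains big_map big_enum.
rewrite (sum_TAdC_size (fun e => (-1) ^+ size e *: Tterm K e)).
congr (_ - _); apply: eq_bigr => n _; apply: eq_bigr => c _.
by rewrite size_tuple.
Qed.
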